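(* Let $(X,d,\mu)$, $\Omega$, $\theta\in[0,1)$, the boundary measure $\mathscr H$ on $\partial\Omega$, the double-phase function $\mathcal H$, the trace operator $T$ and the functional $\mathcal J_f$ be as in the context, where $\Omega$ is bounded, $\mathcal H$ satisfies the local comparability condition on $\overline\Omega$, and $\Omega$ supports the weak $(1,1)$-Poincaré inequality. Let $f\in L^{\widetilde{\mathcal H}}(\partial\Omega)$ satisfy $\int_{\partial\Omega}f\,d\mathscr H=0$, and let $I(f)=\inf_{u\in N^{1,\mathcal H}_*(\Omega)}\mathcal J_f(u)$. Then the set of minimizers $$\mathcal M:=\{u\in N^{1,\mathcal H}_*(\Omega):\mathcal J_f(u)=I(f)\}$$ is convex and norm-closed.
   Context: Setting. $(X,d,\mu)$ is a complete metric measure space, where $\mu$ is a $\sigma$-finite Borel regular measure with $0<\mu(B(x,r))<\infty$ for every open ball. $\Omega\subset X$ is a domain such that $0<\mu(B(x,r)\cap\Omega)<\infty$ for all $x\in\overline\Omega$, $r>0$, and $\mu$ satisfies the restricted doubling condition on $\Omega$: there is $C\ge1$ with $\mu(B(x,2r)\cap\Omega)\le C\mu(B(x,r)\cap\Omega)$ for all $x\in\overline\Omega$, $r>0$. $\mathscr H$ is a $\sigma$-finite Borel regular measure on $\partial\Omega$ satisfying, for a fixed $0\le\theta<1$, the upper codimension-$\theta$ condition: there is $C_\theta>0$ with $\mathscr H(B(x,r)\cap\partial\Omega)\le C_\theta\, r^{-\theta}\mu(B(x,r)\cap\Omega)$ for all $x\in\partial\Omega$, $r>0$. Double-phase function. $\mathcal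 H(x,\xi)=\xi^{p(x)}+a(x)\xi^{q(x)}$ for $x\in\overline\Omega$, $\xi\ge0$, where $p,q,a$ are measurable on $\overline\Omega$, $1<p(x)<q(x)<\infty$ for all $x$, $1<p^-:=\operatorname{ess\,inf}p\le p^+:=\operatorname{ess\,sup}p<\infty$, $1<q^-:=\operatorname{ess\,inf}q\le q^+:=\operatorname{ess\,sup}q<\infty$, and $0\le a\in L^\infty$. These conditions are assumed on $\overline\Omega$ with respect to $\mu$, and on $\partial\Omega$ with respect to $\mathscr H$. The complementary function is $\widetilde{\mathcal H}(x,\xi)=\sup_{s\ge0}\{s\xi-\mathcal H(x,s)\}$. Spaces. $L^{\mathcal H}(\Omega)$ is the space of measurable $u$ on $\Omega$ with $\varrho_{\mathcal H}(u)=\int_\Omega\mathcal H(x,|u|)\,d\mu<\infty$, with Luxemburg norm $\|u\|=\inf\{\tau>0:\varrho_{\mathcal H}(u/\tau)\le1\}$; $L^{\mathcal H}(\partial\Omega)$ and $L^{\widetilde{\mathcal H}}(\partial\Omega)$ are defined in the same way on $\partial\Omega$ with measure $\mathscr H$ and functions $\mathcal H$, $\widetilde{\mathcal H}$ respectively. Rectifiable curves are nonconstant, continuous, of finite length $\ell_\gamma$ and parametrized on $[0,\ell_\gamma]$. The $\mathcal H$-modulus of a family $\Gamma$ of rectifiable curves in $\Omega$ is $\inf\int_\Omega\mathcal H(x,h)\,d\mu$ over Borel $h\ge0$ (values in $[0,\infty]$) with $\int_\gamma h\,ds\ge1$ for all $\gamma\in\Gamma$ ($\infty$ if there is no such $h$).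 A nonnegative Borel function $g$ on $\Omega$ is an $\mathcal H$-weak upper gradient of a measurable $u:\Omega\to[-\infty,\infty]$ if $|u(\gamma(0))-u(\gamma(\ell_\gamma))|\le\int_\gamma g\,ds$ for all rectifiable curves $\gamma$ in $\Omega$ outside a family of $\mathcal H$-modulus zero (with $|(\pm\infty)-(\pm\infty)|=\infty$). If $u$ has an $\mathcal H$-weak upper gradient in $L^{\mathcal H}(\Omega)$, then $g_u$ denotes the minimal one ($g_u\le g$ $\mu$-a.e. for every $\mathcal H$-weak upper gradient $g\in L^{\mathcal H}(\Omega)$ of $u$), which exists and is $\mu$-a.e. unique. $N^{1,\mathcal H}(\Omega)$ is the (Banach) space of everywhere-defined $u\in L^{\mathcal H}(\Omega)$ having an $\mathcal H$-weak upper gradient in $L^{\mathcal H}(\Omega)$, with norm $\|u\|_{N^{1,\mathcal H}(\Omega)}=\|u\|_{L^{\mathcal H}(\Omega)}+\|g_u\|_{L^{\mathcal H}(\Omega)}$, modulo $u\sim v$ iff $\|u-v\|=0$. $N^{1,\mathcal H}_*(\Omega)=\{u\in N^{1,\mathcal H}(\Omega):\int_\Omega u\,d\mu=0\}$, with the norm of $N^{1,\mathcal H}(\Omega)$. Local comparability. $\mathcal H$ satisfies the local comparability condition on $E$ if there exist $C\ge1$ and $R_0>0$ such that for every ball $B\subset X$ of radius less than $R_0$, all $x,y\in B\cap E$ and all $\xi\in[0,\infty)$, $\mathcal H(x,\xi)\le C\,\mathcal H(y,C\xi)$. Weak $(1,1)$-Poincaré inequality. $\Omega$ supports it if there are $C>0$,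 $\lambda>1$ such that for every $u\in L^1_{\mathrm{loc}}(\Omega)$ (integrable on bounded subsets of $\Omega$) with minimal $\mathcal H$-weak upper gradient $g_u$, $\frac1{\mu(B)}\int_B|u-u_B|\,d\mu\le C r\frac1{\mu(\lambda B\cap\Omega)}\int_{\lambda B\cap\Omega}g_u\,d\mu$ for every ball $B=B(x,r)\subset\Omega$; by convention, this assumption includes the same inequality with $B$ replaced by $B\cap\Omega$ on the left-hand side (averages over $B\cap\Omega$) for every ball $B=B(x,r)$ with $x\in\overline\Omega$. Here $u_A=\frac1{\mu(A)}\int_A u\,d\mu$ and $\lambda B=B(x,\lambda r)$. Trace and energy. Under boundedness of $\Omega$, local comparability on $\overline\Omega$ and the weak $(1,1)$-Poincaré inequality, there is a bounded linear trace operator $T:N^{1,\mathcal H}(\Omega)\to L^{\mathcal H}(\partial\Omega)$ characterized by $\lim_{r\to0}\frac1{\mu(B(z,r)\cap\Omega)}\int_{B(z,r)\cap\Omega}|u-Tu(z)|\,d\mu=0$ for $\mathscr H$-a.e. $z\in\partial\Omega$. With $\mathcal A(x,\xi)=\frac{\xi^{p(x)}}{p(x)}+a(x)\frac{\xi^{q(x)}}{q(x)}$, set $$\mathcal J_f(u)=\int_\Omega\mathcal A(x,g_u)\,d\mu+\int_{\partial\Omega}f\,Tu\,d\mathscr H,\quad u\in N^{1,\mathcal H}(\Omega).$$ *)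

(* Defs.v *)
From HB Require Import structures.
From mathcomp Require Import all_boot all_order all_algebra.
From mathcomp Require Import all_classical all_reals all_analysis.
From mathcomp Require Import measurable_realfun.

Set Implicit Arguments.
Unset Strict Implicit.
Unset Printing Implicit Defensive.

Import Order.TTheory GRing.Theory Num.Theory.
Import numFieldNormedType.Exports.

Local Open Scope classical_set_scope.
Local Open Scope ring_scope.
Local Open Scope ereal_scope.

#[short(type="completeMetricType")]
HB.structure Definition CompleteMetric (R : numDomainType) :=
  {T of Metric R T & Complete T}.

(* Functions on a subset D of the space are total functions whose values
   outside D are never used. *)

Section musielak_orlicz.
Context {d : measure_display} {T : measurableType d} {R : realType}.
Variables (m : {measure set T -> \bar R}) (D : set T).

Definition ess_sup_on (f : T -> R) : \bar R :=
  ereal_inf [set y : \bar R | {ae m, forall x, D x -> (f x)%:E <= y}].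

Definition ess_inf_on (f : T -> R) : \bar R :=
  ereal_sup [set y : \bar R | {ae m, forall x, D x -> y <= (f x)%:E}].

Definition modular (Phi : T -> \bar R -> \bar R) (u : T -> \bar R) : \bar R :=
  \int[m]_(x in D) Phi x `|u x|.

Definition orlicz_space (Phi : T -> \bar R -> \bar R) : set (T -> \bar R) :=
  [set u | measurable_fun D u /\ modular Phi u < +oo].

Definition luxnorm (Phi : T -> \bar R -> \bar R) (u : T -> \bar R) : \bar R :=
  ereal_inf [set t%:E | t in
    [set t : R | (0 < t)%R /\ modular Phi (fun x => (t^-1)%:E * u x) <= 1]].

Definition avg (A : set T) (u : T -> \bar R) : \bar R :=
  (m A)^-1 * \int[m]_(x in A) u x.

Record double_phase_on (p q a : T -> R) : Prop := DoublePhaseOn {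
  dp_measurable_p : measurable_fun D p ;
  dp_measurable_q : measurable_fun D q ;
  dp_measurable_a : measurable_fun D a ;
  dp_exponents : forall x, D x -> (1 < p x)%R /\ (p x < q x)%R ;
  dp_weight : forall x, D x -> (0 <= a x)%R ;
  dp_inf_p : 1 < ess_inf_on p ;
  dp_sup_p : ess_sup_on p < +oo ;
  dp_inf_q : 1 < ess_inf_on q ;
  dp_sup_q : ess_sup_on q < +oo ;
  dp_sup_a : ess_sup_on a < +oo }.

End musielak_orlicz.

Section double_phase.
Context {T : Type} {R : realType}.
Implicit Types (p q a : T -> R) (x : T) (xi : \bar R).

Definition double_phase p q a x xi : \bar R :=
  xi `^ p x + (a x)%:E * xi `^ q x.

Definition energy_density p q a x xi : \bar R :=
  ((p x)^-1)%:E * xi `^ p x + (a x / q x)%:E * xi `^ q x.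

Definition complementary (Phi : T -> \bar R -> \bar R) x xi : \bar R :=
  ereal_sup [set s%:E * xi - Phi x s%:E | s in [set s : R | (0 <= s)%R]].

End double_phase.

Section metric_measure.
Context {R : realType} {X : completeMetricType R}.

Definition borelType := g_sigma_algebraType (@open X).

(* A measure in the sense of geometric measure theory is an outer measure;
   mu-measurable means Caratheodory measurable. *)
Definition cara (mu : {outer_measure set X -> \bar R}) :
  {measure set (caratheodory_type mu) -> \bar R} := mu.

Definition borel_regular (mu : {outer_measure set X -> \bar R}) : Prop :=
  (forall A : set X, (@open X).-sigma.-measurable A -> mu.-cara.-measurable A)
  /\ forall A : set X, exists B : set X,
       [/\ (@open X).-sigma.-measurable B, A `<=` B & mu B = mu A].

Definition is_domain (Om : set X) : Prop :=
  [/\ open Om, connected Om & Om !=set0].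

Definition metric_bounded (A : set X) : Prop :=
  exists x : X, exists r : R, A `<=` ball x r.

Definition bd (Om : set X) : set X := closure Om `\` Om°.

Definition restricted_doubling (mu : {outer_measure set X -> \bar R})
    (Om : set X) : Prop :=
  exists2 C : R, (1 <= C)%R &
    forall (x : X) (r : R), closure Om x -> (0 < r)%R ->
      mu (ball x (2 * r)%R `&` Om) <= C%:E * mu (ball x r `&` Om).

Definition upper_codimension (mu nu : {outer_measure set X -> \bar R})
    (Om : set X) (theta : R) : Prop :=
  exists2 C : R, (0 < C)%R &
    forall (x : X) (r : R), bd Om x -> (0 < r)%R ->
      nu (ball x r `&` bd Om) <=
        (C * r `^ (- theta))%:E * mu (ball x r `&` Om).

Definition local_comparability (Phi : X -> \bar R -> \bar R) (E : set X) :
    Prop :=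
  exists C : R, exists R0 : R, [/\ (1 <= C)%R, (0 < R0)%R &
    forall (z : X) (r : R), (0 < r)%R -> (r < R0)%R ->
    forall x y : X, (ball z r `&` E) x -> (ball z r `&` E) y ->
    forall xi : R, (0 <= xi)%R ->
      Phi x xi%:E <= C%:E * Phi y (C * xi)%:E].

Record curve := Curve { clen : R ; cpath : R -> X }.

Definition polygon_length (gamma : R -> X) (a : R) (s : seq R) : R :=
  (\sum_(0 <= i < size s)
     mdist (gamma (nth a (a :: s) i)) (gamma (nth a (a :: s) i.+1)))%R.

Definition curve_length (gamma : R -> X) (a b : R) : \bar R :=
  ereal_sup [set (polygon_length gamma a s)%:E | s in itv_partition a b].

(* The parametrization on [0, length] is the one by arc length, which is what
   makes the line integral below the integral with respect to ds. *)
Definition rectifiable_in (Om : set X) (c : curve) : Prop :=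
  [/\ (0 < clen c)%R,
      {within `[0%R, clen c], continuous (cpath c)},
      (forall t : R, (0 <= t <= clen c)%R -> Om (cpath c t)) &
      forall s t : R, (0 <= s)%R -> (s <= t)%R -> (t <= clen c)%R ->
        curve_length (cpath c) s t = (t - s)%:E].

Definition line_integral (c : curve) (h : X -> \bar R) : \bar R :=
  \int[lebesgue_measure]_(t in `[0%R, clen c]) h (cpath c t).

Definition nonneg_borel_on (Om : set X) (h : X -> \bar R) : Prop :=
  measurable_fun (Om : set borelType) (h : borelType -> \bar R) /\
  forall x, Om x -> 0 <= h x.

Section newtonian.
Variables (mu : {outer_measure set X -> \bar R}) (Om : set X).
Variable Phi : X -> \bar R -> \bar R.

Definition curve_modulus (Gamma : set curve) : \bar R :=
  ereal_inf [set \int[cara mu]_(x in Om) Phi x (h x) | h in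
    [set h : X -> \bar R | nonneg_borel_on Om h /\
       forall c, Gamma c -> 1 <= line_integral c h]].

(* The subtraction of \bar R has an infinite value on any two infinite
   arguments, as required of |u(gamma(0)) - u(gamma(l))|. *)
Definition weak_upper_gradient (u g : X -> \bar R) : Prop :=
  nonneg_borel_on Om g /\
  exists Gamma : set curve,
    [/\ Gamma `<=` rectifiable_in Om, curve_modulus Gamma = 0 &
        forall c, rectifiable_in Om c -> ~ Gamma c ->
          `|u (cpath c 0%R) - u (cpath c (clen c))| <= line_integral c g].

Definition minimal_wug (u g : X -> \bar R) : Prop :=
  [/\ weak_upper_gradient u g, orlicz_space (cara mu) Om Phi g &
      forall g', weak_upper_gradient u g' -> orlicz_space (cara mu) Om Phi g' ->
        {ae cara mu, forall x, Om x -> g x <= g' x}].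

Definition has_wug (u : X -> \bar R) : Prop :=
  exists2 g, weak_upper_gradient u g & orlicz_space (cara mu) Om Phi g.

(* gr chooses a minimal weak upper gradient of every measurable function that
   has a weak upper gradient in L^Phi; it is unique up to null sets. *)
Definition minimal_wug_map (gr : (X -> \bar R) -> X -> \bar R) : Prop :=
  forall u, measurable_fun (Om : set (caratheodory_type mu)) u ->
    has_wug u -> minimal_wug u (gr u).

(* Elements are functions, not classes; the equivalence of u and v is
   N1norm gr (u \- v) = 0. *)
Definition N1 : set (X -> \bar R) :=
  [set u | orlicz_space (cara mu) Om Phi u /\ has_wug u].

Definition N1norm (gr : (X -> \bar R) -> X -> \bar R) (u : X -> \bar R) :
    \bar R :=
  luxnorm (cara mu) Om Phi u + luxnorm (cara mu) Om Phi (gr u).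

Definition N1star : set (X -> \bar R) :=
  [set u | N1 u /\ \int[cara mu]_(x in Om) u x = 0].

Definition L1loc (u : X -> \bar R) : Prop :=
  forall A : set X, mu.-cara.-measurable A -> A `<=` Om -> metric_bounded A ->
    (cara mu).-integrable A u.

(* The balls contained in Om are among the balls centred in the closure of
   Om, and for them B `&` Om = B. *)
Definition weak_poincare : Prop :=
  exists C : R, exists lambda : R, [/\ (0 < C)%R, (1 < lambda)%R &
    forall u g, L1loc u -> minimal_wug u g ->
    forall (x : X) (r : R), closure Om x -> (0 < r)%R ->
      let B := ball x r `&` Om in
      avg (cara mu) B (fun y => `|u y - avg (cara mu) B u|) <=
        (C * r)%:E * avg (cara mu) (ball x (lambda * r)%R `&` Om) g].

Record trace_operator (nu : {outer_measure set X -> \bar R})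
    (gr T : (X -> \bar R) -> X -> \bar R) : Prop := TraceOperator {
  trace_orlicz : forall u, N1 u -> orlicz_space (cara nu) (bd Om) Phi (T u) ;
  trace_linear : forall (k l : R) u v, N1 u -> N1 v ->
    {ae cara nu, forall z, bd Om z ->
      T (fun x => k%:E * u x + l%:E * v x) z = k%:E * T u z + l%:E * T v z} ;
  trace_bounded : exists C : R, forall u, N1 u ->
    luxnorm (cara nu) (bd Om) Phi (T u) <= C%:E * N1norm gr u ;
  trace_lim : forall u, N1 u ->
    {ae cara nu, forall z, bd Om z ->
      avg (cara mu) (ball z r `&` Om) (fun x => `|u x - T u z|)
        @[r --> (0:R)^'+] --> (0 : \bar R)} }.

Definition fun_convex (M : set (X -> \bar R)) : Prop :=
  forall u v (t : R), M u -> M v -> (0 <= t <= 1)%R ->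
    M (fun x => t%:E * u x + (1 - t)%:E * v x).

(* Closedness in the normed space N1; since v with N1norm gr (v \- u) = 0 is
   in the closure of [set u], a closed set is a union of equivalence classes. *)
Definition N1closed (gr : (X -> \bar R) -> X -> \bar R)
    (M : set (X -> \bar R)) : Prop :=
  forall u, N1 u ->
    (forall e : R, (0 < e)%R ->
       exists2 v, M v & N1norm gr (fun x => v x - u x) < e%:E) ->
    M u.

End newtonian.

Section energy.
Variables (mu nu : {outer_measure set X -> \bar R}) (Om : set X).
Variables (p q a : X -> R).
Variables (gr T : (X -> \bar R) -> X -> \bar R) (f : X -> \bar R).

Definition energy (u : X -> \bar R) : \bar R :=
  \int[cara mu]_(x in Om) energy_density p q a x (gr u x) +
  \int[cara nu]_(z in bd Om) (f z * T u z).

Definition min_energy : \bar R :=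
  ereal_inf [set energy u | u in N1star mu Om (double_phase p q a)].

Definition minimizers : set (X -> \bar R) :=
  [set u | N1star mu Om (double_phase p q a) u /\ energy u = min_energy].

End energy.

End metric_measure.

(* Main.v *)
(** I(f) never has to be bounded below: a minimizer has finite energy, so I(f)
    is finite as soon as the set of minimizers is nonempty.

    Convexity: t g_u + (1 - t) g_v is a weak upper gradient of t u + (1 - t) v,
    so the gradient part of the energy is convex by minimality of g and
    convexity of xi |-> A(x, xi), while the trace part is linear.

    Closedness: it is enough that J_f(u) <= liminf J_f(v) as v -> u in norm.
    The trace part is Lipschitz by Young's inequality and boundedness of T.  For
    the gradient part, g_u <= g_v + g_(v - u) a.e., and convexity together with
    the bounded exponents gives (1 - e)^n J(u) <= J(v) + e as soon as
    |g_(v - u)| < e in Luxemburg norm. *)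

Require Import Defs.
From mathcomp Require Import all_boot all_order all_algebra.
From mathcomp Require Import all_classical all_reals all_analysis.
From mathcomp Require Import measurable_realfun ring lra.

Set Implicit Arguments.
Unset Strict Implicit.
Unset Printing Implicit Defensive.

Import Order.TTheory GRing.Theory Num.Theory.
Import numFieldNormedType.Exports.

Local Open Scope classical_set_scope.
Local Open Scope ring_scope.
Local Open Scope ereal_scope.

(** * The double phase function of an extended real argument *)

Section two_power.
Context {R : realType}.
Implicit Types (b c r s k : R) (x y : \bar R).

(** Common form of [double_phase] ([b = 1], [c = a x]) and of [energy_density] ([b = 1 / p x],
    [c = a x / q x]), so that monotonicity, convexity and growth are proved once for both. *)
Definition two_power b c r s x : \bar R := b%:E * x `^ r + c%:E * x `^ s.

Lemma le_poweR x y r : (0 <= r)%R -> 0 <= x -> x <= y -> x `^ r <= y `^ r.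
Proof.
move=> r0 x0 xy; apply: gt0_ler_poweR => //; rewrite !in_itv/= leey andbT//.
exact: le_trans xy.
Qed.

(** Convexity of the real power, extended to infinite arguments. The weights [k = 0] and [k = 1]
    come first because [0 * +oo = 0]; for the other weights an infinite argument makes the right
    side [+oo]. *)
Lemma poweR_convex k r x y : (0 <= k <= 1)%R -> (1 <= r)%R ->
  0 <= x -> 0 <= y ->
  (k%:E * x + (1 - k)%:E * y) `^ r <= k%:E * x `^ r + (1 - k)%:E * y `^ r.
Proof.
move=> /andP[k0 k1] r1 x0 y0; have r0 : (0 < r)%R by apply: lt_le_trans r1.
have k'0 : (0 <= 1 - k)%R by rewrite subr_ge0.
have [->|kn0] := eqVneq k 0%R.
  by rewrite !mul0e !add0e subr0 !mul1e.
have [->|kn1] := eqVneq k 1%R.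
  by rewrite subrr !mul0e !adde0 !mul1e.
have kp : (0 < k)%R by rewrite lt_neqAle eq_sym kn0.
have k'p : (0 < 1 - k)%R by rewrite subr_gt0 lt_neqAle kn1.
have neqNy (z : \bar R) : 0 <= z -> z != -oo by case: z.
case: x x0 => [x|_|//]; last first.
  rewrite poweRyr ?gt_eqF// (gt0_muley (x := k%:E)) ?lte_fin//.
  by rewrite [X in _ <= X]addye ?leey ?neqNy ?mule_ge0 ?lee_fin ?poweR_ge0.
case: y y0 => [y|_|//]; last first.
  rewrite poweRyr ?gt_eqF// (gt0_muley (x := (1 - k)%:E)) ?lte_fin// => x0.
  by rewrite [X in _ <= X]addey ?leey ?neqNy ?mule_ge0 ?lee_fin ?powR_ge0.
rewrite !lee_fin => y0 x0.
have /= := @convex_powR R r r1 (Itv01 k0 k1) x y.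
rewrite !inE/= !in_itv/= !andbT => /(_ x0 y0).
by rewrite !convRE.
Qed.

Variables (b c r s : R).
Hypotheses (b0 : (0 <= b)%R) (c0 : (0 <= c)%R).
Hypotheses (r1 : (1 <= r)%R) (s1 : (1 <= s)%R).

Let r0 : (0 <= r)%R. Proof. exact: le_trans r1. Qed.
Let s0 : (0 <= s)%R. Proof. exact: le_trans s1. Qed.

Lemma two_power_ge0 x : 0 <= two_power b c r s x.
Proof. by rewrite adde_ge0 ?mule_ge0 ?lee_fin ?poweR_ge0. Qed.

Lemma le_two_power x y : 0 <= x -> x <= y ->
  two_power b c r s x <= two_power b c r s y.
Proof. by move=> x0 xy; rewrite leeD// lee_wpmul2l ?lee_fin ?le_poweR. Qed.

Lemma two_power_convex k x y : (0 <= k <= 1)%R -> 0 <= x -> 0 <= y ->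
  two_power b c r s (k%:E * x + (1 - k)%:E * y) <=
  k%:E * two_power b c r s x + (1 - k)%:E * two_power b c r s y.
Proof.
move=> k01 x0 y0; have /andP[k0 k1] := k01.
have k'0 : (0 <= 1 - k)%R by rewrite subr_ge0.
rewrite /two_power !ge0_muleDr ?mule_ge0 ?lee_fin ?poweR_ge0//.
rewrite addeACA; apply: leeD.
  apply: le_trans (lee_wpmul2l _ (poweR_convex k01 r1 x0 y0)) _.
    by rewrite lee_fin.
  by rewrite ge0_muleDr ?mule_ge0 ?lee_fin ?poweR_ge0// !(muleCA b%:E).
apply: le_trans (lee_wpmul2l _ (poweR_convex k01 s1 x0 y0)) _.
  by rewrite lee_fin.
by rewrite ge0_muleDr ?mule_ge0 ?lee_fin ?poweR_ge0// !(muleCA c%:E).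
Qed.

(** For [0 < k <= 1] the power of [k] decreases in the exponent, so [k ^+ n] lies below both [k ^ r]
    and [k ^ s]. *)
Lemma two_power_contract (n : nat) k x : (0 < k <= 1)%R -> (r <= n%:R)%R ->
  (s <= n%:R)%R -> 0 <= x ->
  (k ^+ n)%:E * two_power b c r s x <= two_power b c r s (k%:E * x).
Proof.
move=> /andP[k0 k1] rn sn x0.
have kpow t : (t <= n%:R)%R -> (k ^+ n <= k `^ t)%R.
  move=> tn; rewrite -powR_mulrn; last exact: ltW.
  by apply: ger_powR => //; rewrite k0 k1.
rewrite ge0_muleDr ?mule_ge0 ?lee_fin ?poweR_ge0//.
have H t u : (0 <= u)%R -> (t <= n%:R)%R ->
    (k ^+ n)%:E * (u%:E * x `^ t) <= u%:E * (k%:E * x) `^ t.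
  move=> u0 tn; rewrite poweRM ?lee_fin ?(ltW k0)// muleCA.
  apply: lee_wpmul2l; first by rewrite lee_fin.
  apply: lee_wpmul2r; first exact: poweR_ge0.
  by rewrite poweR_EFin lee_fin kpow.
by rewrite leeD ?H.
Qed.

(** The doubling property of the growth function: the contraction estimate with factor [k^-1] at the
    point [k * x]. *)
Lemma two_power_dilate (n : nat) k x : (1 <= k)%R -> (r <= n%:R)%R ->
  (s <= n%:R)%R -> 0 <= x ->
  two_power b c r s (k%:E * x) <= (k ^+ n)%:E * two_power b c r s x.
Proof.
move=> k1 rn sn x0; have k0 : (0 < k)%R by apply: lt_le_trans k1.
have := @two_power_contract n k^-1 (k%:E * x).
rewrite invr_gt0 k0 invf_le1// k1 muleA -EFinM mulVf ?gt_eqF// mul1e.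
move=> /(_ isT rn sn); rewrite mule_ge0 ?lee_fin ?(ltW k0)// => /(_ isT) H.
have kn0 : (0 <= k ^+ n)%R by rewrite exprn_ge0// ltW.
have := lee_wpmul2l (x := (k ^+ n)%:E) _ H.
rewrite lee_fin kn0 muleA -EFinM exprVn mulfV ?mul1e; first exact.
by rewrite expf_neq0// gt_eqF.
Qed.

End two_power.

Lemma le_two_power_coef (R : realType) (b c b' c' r s : R) x :
  (b <= b')%R -> (c <= c')%R ->
  two_power b c r s x <= two_power b' c' r s x.
Proof. by move=> bb cc; rewrite leeD// lee_wpmul2r ?poweR_ge0 ?lee_fin. Qed.

Lemma double_phaseE (T : Type) (R : realType) (p q a : T -> R) x xi :
  double_phase p q a x xi = two_power 1 (a x) (p x) (q x) xi.
Proof. by rewrite /double_phase /two_power mul1e. Qed.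

(** * Measurability of powers with variable exponent *)

Section measurable_two_power.
Context d (T : measurableType d) (R : realType) (D : set T).
Hypothesis mD : measurable D.

Lemma measurable_powR2 (f g : T -> R) :
  measurable_fun D f -> measurable_fun D g ->
  measurable_fun D (fun x => (f x `^ g x)%R).
Proof.
move=> mf mg; rewrite /powR; apply: measurable_fun_if => //.
- exact: measurable_fun_eqr.
- apply: (@measurableT_comp _ _ _ _ _ _ (fun b : bool => b%:R : R)) => //.
  apply: measurable_fun_eqr => //.
  apply: measurable_funS mg => //; exact: subIsetl.
- apply: measurableT_comp => //; apply: measurable_funM.
    by apply: measurable_funS mg => //; exact: subIsetl.
  apply: measurableT_comp => //; apply: measurable_funS mf => //; exact: subIsetl.
Qed.

(** On nonnegative reals the inverse is the power with exponent -1, also at 0, where both are 0 by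
    convention. *)
Lemma measurable_fun_invr_ge0 (f : T -> R) : (forall x, D x -> 0 <= f x)%R ->
  measurable_fun D f -> measurable_fun D (fun x => (f x)^-1)%R.
Proof.
move=> f0 mf; apply: (eq_measurable_fun (fun x => (f x `^ (-1))%R)).
  by move=> x /set_mem Dx; rewrite powR_inv1// f0.
exact: measurable_powR2.
Qed.

Lemma measurable_poweR2 (f : T -> \bar R) (g : T -> R) :
  (forall x, D x -> 0 <= f x) -> (forall x, D x -> 0 < g x)%R ->
  measurable_fun D f -> measurable_fun D g ->
  measurable_fun D (fun x => f x `^ g x).
Proof.
move=> f0 g0 mf mg.
(* The value [+oo] is split off, which leaves a real power; positivity of the exponent makes the
   power of [+oo] again [+oo]. *)
apply: (eq_measurable_fun (fun x => if f x == +oo then +oo else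
    ((fine (f x)) `^ g x)%:E)).
  move=> x /set_mem Dx; case: ifPn => [/eqP ->|].
    by rewrite poweRyr// gt_eqF// g0.
  by case: (f x) (f0 _ Dx).
apply: measurable_fun_if => //.
- exact: measurable_fun_eqe.
- apply/measurable_EFinP.
  apply: (measurable_funS mD); first exact: subIsetl.
  by apply: measurable_powR2 => //; exact: measurableT_comp.
Qed.

Lemma measurable_two_power (b c r s : T -> R) (f : T -> \bar R) :
  (forall x, D x -> 0 <= f x) ->
  (forall x, D x -> 0 < r x)%R -> (forall x, D x -> 0 < s x)%R ->
  measurable_fun D b -> measurable_fun D c ->
  measurable_fun D r -> measurable_fun D s -> measurable_fun D f ->
  measurable_fun D (fun x => two_power (b x) (c x) (r x) (s x) (f x)).
Proof.
move=> f0 r0 s0 mb mc mr ms mf; apply: emeasurable_funD.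
  by apply: emeasurable_funM; [exact/measurable_EFinP|exact: measurable_poweR2].
by apply: emeasurable_funM; [exact/measurable_EFinP|exact: measurable_poweR2].
Qed.

End measurable_two_power.

(** * Orlicz spaces of the double phase function *)

Section lower_integral.
Import HBNNSimple.
Context d (T : measurableType d) (R : realType).
Variables (m : {measure set T -> \bar R}) (D : set T).

(* The integral of a nonnegative function is a supremum over simple functions
   below it, so no measurability is needed. *)
Lemma le_lower_integral (f g : T -> \bar R) :
  (forall x, D x -> 0 <= f x) -> (forall x, D x -> f x <= g x) ->
  \int[m]_(x in D) f x <= \int[m]_(x in D) g x.
Proof.
move=> f0 fg; have g0 x : D x -> 0 <= g x.
  by move=> Dx; exact: le_trans (f0 _ Dx) (fg _ Dx).
rewrite !ge0_integralE//; apply: le_ereal_sup => _ [h hf <-]; exists h => //= x.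
apply: le_trans (hf x) _; rewrite !patchE; case: ifPn => // /set_mem.
exact: fg.
Qed.

End lower_integral.

Section double_phase_on.
Context d (T : measurableType d) (R : realType).
Variables (m : {measure set T -> \bar R}) (D : set T).
Hypothesis mD : measurable D.
Variables p q a : T -> R.

(** Almost-everywhere bounds restrict to subsets, so the essential bounds can only improve. This
    carries the assumptions from the closure of [Om] to [Om]. *)
Lemma double_phase_onS (E : set T) : E `<=` D ->
  double_phase_on m D p q a -> double_phase_on m E p q a.
Proof.
move=> ED [mp mq ma pq a0 ip sp iq sq sa].
have aeS (P : T -> Prop) :
    {ae m, forall x, D x -> P x} -> {ae m, forall x, E x -> P x}.
  by apply: filterS => x Px /ED; exact: Px.
have supS (h : T -> R) : ess_sup_on m E h <= ess_sup_on m D h.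
  by apply: ereal_inf_le_tmp => y /=; exact: (@aeS (fun x => (h x)%:E <= y)).
have infS (h : T -> R) : ess_inf_on m D h <= ess_inf_on m E h.
  by apply: le_ereal_sup => y /=; exact: (@aeS (fun x => y <= (h x)%:E)).
split; try exact: (measurable_funS mD).
- by move=> x /ED; exact: pq.
- by move=> x /ED; exact: a0.
- exact: lt_le_trans (infS _).
- exact: le_lt_trans (supS _) _.
- exact: lt_le_trans (infS _).
- exact: le_lt_trans (supS _) _.
- exact: le_lt_trans (supS _) _.
Qed.

Hypothesis dp : double_phase_on m D p q a.
Let Phi := double_phase p q a.

Lemma dp_p_ge1 x : D x -> (1 <= p x)%R.
Proof. by move=> /(dp_exponents dp)[/ltW]. Qed.

Lemma dp_q_ge1 x : D x -> (1 <= q x)%R.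
Proof. by move=> /(dp_exponents dp)[p1 pq]; exact/ltW/(lt_trans p1). Qed.

(** Since [p < q], a bound on [q] suffices. A natural number is chosen so that the growth estimates
    use the ring power [k ^+ n]. *)
Lemma dp_exponent_bound :
  exists n : nat, {ae m, forall x, D x -> (p x <= n%:R)%R /\ (q x <= n%:R)%R}.
Proof.
have /ereal_inf_lt[y /= Hy yoo] := dp_sup_q dp.
exists (Num.truncn (fine y)).+1; apply: filterS Hy => x Hx Dx.
have qn : (q x <= (Num.truncn (fine y)).+1%:R)%R.
  have := Hx Dx; case: y yoo {Hx} => [y _|//|//]; rewrite lee_fin => qy.
  by apply: le_trans qy _; apply/ltW; exact: truncnS_gt.
by split=> //; apply: le_trans qn; apply: ltW; exact: (dp_exponents dp Dx).2.
Qed.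

Lemma double_phase_ge0 x xi : D x -> 0 <= Phi x xi.
Proof.
by move=> Dx; rewrite /Phi double_phaseE two_power_ge0//; exact: (dp_weight dp Dx).
Qed.

Lemma le_double_phase x xi eta : D x -> 0 <= xi -> xi <= eta ->
  Phi x xi <= Phi x eta.
Proof.
move=> Dx xi0 xe; rewrite /Phi !double_phaseE le_two_power//.
- exact: (dp_weight dp Dx).
- exact: dp_p_ge1.
- exact: dp_q_ge1.
Qed.

(** Above 1, [xi <= xi ^ p] because [p >= 1]. This bound puts the Orlicz space into L^1 on sets of
    finite measure. *)
Lemma double_phase_lin x xi : D x -> 0 <= xi -> xi <= 1 + Phi x xi.
Proof.
move=> Dx xi0; have P0 := double_phase_ge0 xi Dx.
have [xi1|xi1] := leP xi 1; first by rewrite (le_trans xi1)// leeDl.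
have p1 := dp_p_ge1 Dx.
apply: (@le_trans _ _ (xi `^ p x)); last first.
  rewrite /Phi /double_phase -[leLHS]add0e leeD// leeDl// mule_ge0 ?poweR_ge0//.
  by rewrite lee_fin; exact: (dp_weight dp Dx).
case: xi xi1 {xi0 P0} => [xi|_|//]; last first.
  by rewrite poweRyr// gt_eqF// (lt_le_trans _ p1).
by rewrite lte_fin => xi1; rewrite poweR_EFin lee_fin le1r_powR// ltW.
Qed.

Lemma double_phase_fin_num x xi : D x -> 0 <= xi -> Phi x xi < +oo -> xi < +oo.
Proof.
move=> Dx xi0 Poo; apply: le_lt_trans (double_phase_lin Dx xi0) _.
by rewrite lte_add_pinfty// ltry.
Qed.

Lemma measurable_double_phase (f : T -> \bar R) :
  (forall x, D x -> 0 <= f x) -> measurable_fun D f ->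
  measurable_fun D (fun x => Phi x (f x)).
Proof.
move=> f0 mf; under eq_fun do rewrite /Phi double_phaseE.
apply: measurable_two_power => //.
- by move=> x Dx; exact: lt_le_trans (dp_p_ge1 Dx).
- by move=> x Dx; exact: lt_le_trans (dp_q_ge1 Dx).
- exact: (dp_measurable_a dp).
- exact: (dp_measurable_p dp).
- exact: (dp_measurable_q dp).
Qed.

Lemma measurable_modular (f : T -> \bar R) : measurable_fun D f ->
  measurable_fun D (fun x => Phi x `|f x|).
Proof. by move=> mf; apply: measurable_double_phase => //; exact: measurableT_comp. Qed.

(** With [L = 2 max(K, 1)] one has [|w| <= L (|u| / 2 + |v| / 2)]; the doubling property takes out
    [L ^+ n], and convexity separates [u] from [v]. *)
Lemma orlicz_dom (u v w : T -> \bar R) (K : R) : measurable_fun D w ->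
  (forall x, D x -> `|w x| <= K%:E * (`|u x| + `|v x|)) ->
  orlicz_space m D Phi u -> orlicz_space m D Phi v ->
  orlicz_space m D Phi w.
Proof.
move=> mw wuv [mu uoo] [mv voo]; split=> //.
have [n Hn] := dp_exponent_bound.
(* The factor 2 pays for the convex weights 1/2; the maximum with 1 gives [L >= 1], as dilation
   requires. *)
pose L : R := (2 * Num.max K 1)%R.
have K1 : (1 <= Num.max K 1)%R by rewrite le_max lexx orbT.
have L1 : (1 <= L)%R by rewrite /L; lra.
have h01 : (0 <= (2^-1 : R) <= 1)%R by apply/andP; split; lra.
have h0 : (0 <= 2^-1 :> R)%R by lra.
have Ln0 : (0 <= L ^+ n)%R by rewrite exprn_ge0// (le_trans _ L1).
apply: (@le_lt_trans _ _ (\int[m]_(x in D)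
    ((L ^+ n)%:E * (2^-1%:E * Phi x `|u x| + 2^-1%:E * Phi x `|v x|)))).
  apply: ae_ge0_le_integral => //.
  - by move=> x Dx; exact: double_phase_ge0.
  - exact: measurable_modular.
  - by move=> x Dx; rewrite mule_ge0 ?lee_fin// adde_ge0// mule_ge0 ?lee_fin//;
      exact: double_phase_ge0.
  - apply: measurable_funeM; apply: emeasurable_funD; apply: measurable_funeM;
      exact: measurable_modular.
  apply: filterS Hn => x Hn Dx; have [pn qn] := Hn Dx.
  have a0 := dp_weight dp Dx.
  apply: (@le_trans _ _ (Phi x (L%:E * (2^-1%:E * `|u x| + (1 - 2^-1)%:E * `|v x|)))).
    apply: le_double_phase => //; apply: le_trans (wuv _ Dx) _.
    have -> : (1 - 2^-1 = 2^-1 :> R)%R by lra.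
    rewrite -ge0_muleDr ?abse_ge0// muleA -EFinM.
    apply: lee_wpmul2r; first by rewrite adde_ge0 ?abse_ge0.
    rewrite lee_fin /L mulrAC mulfV ?mul1r ?pnatr_eq0//.
    by rewrite le_max lexx.
  rewrite /Phi !double_phaseE.
  apply: (le_trans (two_power_dilate ler01 a0 L1 pn qn _)).
    by rewrite adde_ge0 ?mule_ge0 ?lee_fin ?abse_ge0//; lra.
  apply: lee_wpmul2l; first by rewrite lee_fin.
  apply: le_trans (two_power_convex ler01 a0 _ _ h01 _ _) _ => //.
  - exact: dp_p_ge1.
  - exact: dp_q_ge1.
  by have -> : (1 - 2^-1 = 2^-1 :> R)%R by lra.
have P0 (f : T -> \bar R) x : D x -> 0 <= 2^-1%:E * Phi x `|f x|.
  by move=> Dx; rewrite mule_ge0 ?lee_fin//; exact: double_phase_ge0.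
rewrite ge0_integralZl_EFin//; last 2 first.
- by move=> x Dx; rewrite adde_ge0 ?P0.
- by apply: emeasurable_funD; apply: measurable_funeM; exact: measurable_modular.
rewrite ge0_integralD//; [|exact: P0|by apply: measurable_funeM; exact: measurable_modular
  |exact: P0|by apply: measurable_funeM; exact: measurable_modular].
rewrite !ge0_integralZl_EFin//; try exact: measurable_modular;
  try by move=> x Dx; exact: double_phase_ge0.
by rewrite lte_mul_pinfty ?lee_fin// lte_add_pinfty// lte_mul_pinfty ?lee_fin.
Qed.

Lemma luxnorm_ge0 (Psi : T -> \bar R -> \bar R) (u : T -> \bar R) :
  0 <= luxnorm m D Psi u.
Proof. by apply: le_ereal_inf_tmp => _ [t [t0 _] <-]; rewrite lee_fin ltW. Qed.

(** The infimum provides some [t < e] with modular at most 1, and the modular of [u / t] decreases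
    as [t] grows. *)
Lemma luxnorm_lt (u : T -> \bar R) (e : R) : luxnorm m D Phi u < e%:E ->
  modular m D Phi (fun x => e^-1%:E * u x) <= 1.
Proof.
move=> /ereal_inf_lt[_ [t [t0 Ht] <-]]; rewrite lte_fin => te.
apply: le_trans Ht; apply: le_lower_integral => x Dx.
  exact: double_phase_ge0.
apply: le_double_phase => //; rewrite !abseM; apply: lee_wpmul2r => //.
have e0 : (0 < e)%R by apply: lt_trans te.
by rewrite !gee0_abs ?lee_fin ?invr_ge0 ?(ltW t0) ?(ltW e0)// lef_pV2 ?posrE ?(ltW te).
Qed.

Lemma luxnorm_lt_gt0 (u : T -> \bar R) (e : R) : luxnorm m D Phi u < e%:E ->
  (0 < e)%R.
Proof. by move=> h; rewrite -lte_fin; apply: le_lt_trans h; exact: luxnorm_ge0. Qed.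

Lemma orlicz_le_L1 (u : T -> \bar R) : measurable_fun D u ->
  \int[m]_(x in D) `|u x| <= m D + modular m D Phi u.
Proof.
move=> mu; apply: (@le_trans _ _ (\int[m]_(x in D) (1 + Phi x `|u x|))).
  by apply: le_lower_integral => // x Dx; exact: double_phase_lin.
rewrite ge0_integralD//; [|by move=> x Dx; exact: double_phase_ge0
  |exact: measurable_modular].
by rewrite integral_cst// mul1e.
Qed.

Lemma luxnorm_lt_L1 (u : T -> \bar R) (e : R) : measurable_fun D u ->
  luxnorm m D Phi u < e%:E ->
  \int[m]_(x in D) `|u x| <= e%:E * (m D + 1).
Proof.
move=> mu ue; have e0 := luxnorm_lt_gt0 ue.
have := @orlicz_le_L1 (fun x => e^-1%:E * u x) (measurable_funeM _ mu).
under eq_integral do rewrite abseM gee0_abs ?lee_fin ?invr_ge0 ?(ltW e0)//.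
rewrite ge0_integralZl_EFin ?invr_ge0 ?(ltW e0)//; last exact: measurableT_comp.
(* The L^1 bound was applied to [u / e]; writing 1 as [e * e^-1] restores the scale. *)
move=> H; rewrite -[leLHS]mul1e -[X in X * _ <= _]
  (congr1 EFin (mulfV (lt0r_neq0 e0))) EFinM -muleA.
apply: lee_wpmul2l; first by rewrite lee_fin ltW.
by apply: le_trans H _; apply: leeD2l; exact: (luxnorm_lt ue).
Qed.

Lemma orlicz_integrable (u : T -> \bar R) : m D < +oo ->
  orlicz_space m D Phi u -> m.-integrable D u.
Proof.
move=> Doo [mu uoo]; apply/integrableP; split => //.
by apply: le_lt_trans (orlicz_le_L1 mu) _; rewrite lte_add_pinfty.
Qed.

End double_phase_on.

(** * Young's inequality *)

Section young.
Context d (T : measurableType d) (R : realType).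
Variables (m : {measure set T -> \bar R}) (D : set T).
Hypothesis mD : measurable D.
Variables p q a : T -> R.
Hypothesis dp : double_phase_on m D p q a.
Let Phi := double_phase p q a.

(* The complementary function is a supremum over a continuum; Young's
   inequality is therefore used through this measurable minorant of it. *)
Definition young_gap (f v : T -> \bar R) x : \bar R :=
  maxe 0 (`|f x * v x| - Phi x `|v x|).

Lemma young_gap_ge0 f v x : 0 <= young_gap f v x.
Proof. by rewrite /young_gap le_max lexx. Qed.

(** For finite [v x] the point [s = |v x|] competes in the supremum, and [s = 0] shows the supremum
    to be nonnegative. For infinite [v x] the subtracted term is [+oo] and the gap is 0. *)
Lemma young_gap_le (f v : T -> \bar R) x : D x ->
  young_gap f v x <= complementary Phi x `|f x|.
Proof.
move=> Dx; have p0 := lt_le_trans ltr01 (dp_p_ge1 dp Dx).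
have q0 := lt_le_trans ltr01 (dp_q_ge1 dp Dx).
have a0 := dp_weight dp Dx.
have sup s : (0 <= s)%R ->
    s%:E * `|f x| - Phi x s%:E <= complementary Phi x `|f x|.
  by move=> s0; apply: ereal_sup_ubound; exists s.
have c0 : 0 <= complementary Phi x `|f x|.
  have := sup 0%R (lexx _); rewrite mul0e /Phi /double_phase !poweR0r ?gt_eqF//.
  by rewrite mule0 adde0 sube0.
rewrite /young_gap ge_max c0 /=.
case vE : `|v x| (abse_ge0 (v x)) => [s|//|//].
  by rewrite lee_fin => s0; rewrite abseM vE muleC; exact: sup.
have -> : Phi x +oo = +oo.
  rewrite /Phi /double_phase !poweRyr ?gt_eqF// addye// gt_eqF//.
  by rewrite (lt_le_trans ltNy0)// mule_ge0.
by rewrite addeNy leNye.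
Qed.

Lemma abse_le_young_gap (f v : T -> \bar R) x : D x ->
  `|f x * v x| <= young_gap f v x + Phi x `|v x|.
Proof.
move=> Dx; have P0 : 0 <= Phi x `|v x| by exact: (double_phase_ge0 dp).
have := young_gap_ge0 f v x.
case PE : (Phi x `|v x|) P0 => [s|//|//] _ g0.
  by rewrite -leeBlDr// /young_gap PE le_max lexx orbT.
by rewrite addey ?leey// gt_eqF// (lt_le_trans ltNy0).
Qed.

Lemma measurable_young_gap (f v : T -> \bar R) :
  measurable_fun D f -> measurable_fun D v -> measurable_fun D (young_gap f v).
Proof.
move=> mf mv; apply: measurable_maxe => //; apply: emeasurable_funB.
  by apply: measurableT_comp => //; exact: emeasurable_funM.
exact: (measurable_modular mD dp).
Qed.

Lemma young_integral (f v : T -> \bar R) :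
  measurable_fun D f -> measurable_fun D v ->
  \int[m]_(x in D) `|f x * v x| <=
  modular m D (complementary Phi) f + modular m D Phi v.
Proof.
move=> mf mv.
apply: (@le_trans _ _ (\int[m]_(x in D) (young_gap f v x + Phi x `|v x|))).
  by apply: le_lower_integral => // x; exact: abse_le_young_gap.
rewrite ge0_integralD//.
- rewrite leeD2r// le_lower_integral// => x Dx; [exact: young_gap_ge0|].
  exact: young_gap_le.
- by move=> x Dx; exact: young_gap_ge0.
- exact: measurable_young_gap.
- by move=> x Dx; exact: (double_phase_ge0 dp).
- exact: (measurable_modular mD dp).
Qed.

Lemma orlicz_dual_integrable (f v : T -> \bar R) :
  orlicz_space m D (complementary Phi) f -> orlicz_space m D Phi v ->
  m.-integrable D (fun x => f x * v x).
Proof.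
move=> [mf foo] [mv voo]; apply/integrableP; split; first exact: emeasurable_funM.
by apply: le_lt_trans (young_integral mf mv) _; rewrite lte_add_pinfty.
Qed.

(** Young's inequality for [v / e], whose modular is at most 1, multiplied back by [e]. *)
Lemma young_luxnorm (f v : T -> \bar R) (e : R) :
  measurable_fun D f -> measurable_fun D v -> luxnorm m D Phi v < e%:E ->
  \int[m]_(x in D) `|f x * v x| <= e%:E * (modular m D (complementary Phi) f + 1).
Proof.
move=> mf mv ve; have e0 := luxnorm_lt_gt0 ve.
have := young_integral mf (measurable_funeM (e^-1)%:E mv).
under eq_integral do
  rewrite muleCA abseM gee0_abs ?lee_fin ?invr_ge0 ?(ltW e0)//.
rewrite ge0_integralZl_EFin ?invr_ge0 ?(ltW e0)//; last first.
  by apply: measurableT_comp => //; exact: emeasurable_funM.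
move=> H; rewrite -[leLHS]mul1e -[X in X * _ <= _](congr1 EFin (mulfV (lt0r_neq0 e0))).
rewrite EFinM -muleA; apply: lee_wpmul2l; first by rewrite lee_fin ltW.
by apply: le_trans H _; apply: leeD2l; exact: (luxnorm_lt dp ve).
Qed.

Lemma orlicz_ae_fin_num (v : T -> \bar R) : orlicz_space m D Phi v ->
  {ae m, forall x, D x -> v x \is a fin_num}.
Proof.
move=> [mv voo].
have : m.-integrable D (fun x => Phi x `|v x|).
  apply/integrableP; split; first exact: (measurable_modular mD dp).
  apply: le_lt_trans voo; apply: le_lower_integral => // x Dx.
  by rewrite gee0_abs//; exact: (double_phase_ge0 dp).
move=> /(integrable_ae mD); apply: filterS => x H Dx.
rewrite -abse_fin_num ge0_fin_numE//; apply: (double_phase_fin_num dp Dx) => //.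
by rewrite -ge0_fin_numE ?H//; exact: (double_phase_ge0 dp).
Qed.

(** Young's inequality against the constant function 1: [|f|] is at most an integrable gap plus the
    finite value [Phi x 1 = 1 + a x]. *)
Lemma orlicz_dual_ae_fin_num (f : T -> \bar R) :
  orlicz_space m D (complementary Phi) f ->
  {ae m, forall x, D x -> f x \is a fin_num}.
Proof.
move=> [mf foo]; have m1 : measurable_fun D (fun=> 1 : \bar R) by [].
have : m.-integrable D (young_gap f (fun=> 1)).
  apply/integrableP; split; first exact: measurable_young_gap.
  apply: le_lt_trans foo; apply: le_lower_integral => // x Dx.
  by rewrite gee0_abs ?young_gap_ge0//; exact: young_gap_le.
move=> /(integrable_ae mD); apply: filterS => x H Dx.
rewrite -abse_fin_num ge0_fin_numE//.
have := abse_le_young_gap f (fun=> 1) Dx; rewrite mule1 => /le_lt_trans; apply.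
have := H Dx; rewrite ge0_fin_numE ?young_gap_ge0// => goo.
rewrite lte_add_pinfty// /Phi /double_phase abse1 !poweR1r mule1.
by rewrite -EFinD ltry.
Qed.

End young.

(** * Integrals along curves *)

Section ereal_distance.
Context {R : realType}.
Implicit Types (k l : R) (x y : \bar R).

Lemma abse_lincomb_le k l x y :
  `|k%:E * x + l%:E * y| <= `|k|%:E * `|x| + `|l|%:E * `|y|.
Proof. by apply: le_trans (lee_abs_add _ _) _; rewrite !abseM. Qed.

(** The finite case is the triangle inequality. Otherwise each term on the right has a vanishing
    coefficient, has two finite points, or equals [+oo]; a vanishing coefficient removes the
    corresponding values on the left as well. *)
Lemma lincomb_dist k l (x x' y y' : \bar R) :
  `|(k%:E * x + l%:E * y) - (k%:E * x' + l%:E * y')| <=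
  `|k|%:E * `|x - x'| + `|l|%:E * `|y - y'|.
Proof.
have dist0 (h : R) (s s' : \bar R) : h = 0%R \/ (s \is a fin_num /\ s' \is a fin_num)
    \/ `|h|%:E * `|s - s'| = +oo.
  have [->|h0] := eqVneq h 0%R; first by left.
  right; case: s => [s||]; case: s' => [s'||]; try (by left);
    by right; rewrite /= gt0_muley// lte_fin normr_gt0.
have ge0 (h : R) (s s' : \bar R) : 0 <= `|h|%:E * `|s - s'|.
  by rewrite mule_ge0 ?lee_fin.
have neqNy (z : \bar R) : 0 <= z -> z != -oo by case: z.
case: (dist0 k x x') => [->|[[xf xf']|->]]; last by rewrite addye ?leey ?neqNy.
  rewrite !mul0e !add0e normr0 mul0e add0e.
  case: (dist0 l y y') => [->|[[yf yf']|->]]; last by rewrite leey.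
    by rewrite !mul0e subee// normr0 mul0e abse0.
  by rewrite -muleBr ?abseM// fin_num_adde_defr// fin_numN.
case: (dist0 l y y') => [->|[[yf yf']|->]]; last by rewrite addey ?leey ?neqNy.
  rewrite !mul0e !adde0 normr0 mul0e adde0.
  by rewrite -muleBr ?abseM// fin_num_adde_defr// fin_numN.
move: xf xf' yf yf'.
case: x => [x||//]; case: x' => [x'||//]; case: y => [y||//];
  case: y' => [y'||//] // _ _ _ _.
rewrite -!EFinM -!EFinD /= lee_fin -!normrM.
apply: le_trans (ler_normD _ _); rewrite le_eqVlt; apply/orP; left.
by apply/eqP; congr `|_|%R; ring.
Qed.

(** The triangle inequality for [x = y - (y - x)]; as soon as one of the four values is infinite,
    the right side is [+oo]. It bounds the gradient of [u] by those of [v] and [v - u]. *)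
Lemma dist_le_sub (x x' y y' : \bar R) :
  `|x - x'| <= `|y - y'| + `|(y - x) - (y' - x')|.
Proof.
case: x => [x||]; case: x' => [x'||]; case: y => [y||]; case: y' => [y'||];
  rewrite ?leey//=.
rewrite -?EFinB -?EFinD lee_fin.
apply: le_trans (ler_normB _ _); rewrite le_eqVlt; apply/orP; left.
by apply/eqP; congr `|_|%R; ring.
Qed.

End ereal_distance.

(** * Measurability and linearity of line integrals *)

Section curves.
Context {R : realType} {X : completeMetricType R}.
Variables (Om : set X).
Hypothesis oOm : open Om.

Lemma open_measurable_borel : measurable (Om : set (@borelType R X)).
Proof. exact: sub_sigma_algebra. Qed.

(** Continuity makes preimages of open sets relatively open in the interval, and open sets generate
    the Borel sets. *)
Lemma measurable_curve (c : @curve R X) : rectifiable_in Om c ->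
  measurable_fun `[0%R, clen c] (cpath c : measurableTypeR R -> @borelType R X).
Proof.
move=> [_ /continuousP cc _ _].
apply: (@measurability _ _ (measurableTypeR R) (@borelType R X) _ _ (@open X)) => //.
by move=> _ [A oA <-]; apply: open_measurable_subspace => //; exact: cc.
Qed.

Lemma measurable_along_curve (c : curve) (h : X -> \bar R) :
  rectifiable_in Om c -> nonneg_borel_on Om h ->
  measurable_fun `[0%R, clen c] (h \o cpath c : measurableTypeR R -> \bar R).
Proof.
move=> rc [mh _]; apply: (measurable_comp (F := Om : set borelType)).
- exact: open_measurable_borel.
- move=> _ [t /= ht <-]; case: rc => _ _ + _; apply.
  by move: ht; rewrite in_itv.
- exact: mh.
- exact: measurable_curve.
Qed.

Lemma nonneg_along_curve (c : curve) (h : X -> \bar R) t :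
  rectifiable_in Om c -> nonneg_borel_on Om h -> `[0%R, clen c]%classic t ->
  0 <= h (cpath c t).
Proof.
move=> [_ _ cOm _] [_ h0] ht; apply/h0/cOm.
by move: ht; rewrite /= in_itv.
Qed.

Lemma line_integral_lincomb (c : curve) (g h : X -> \bar R) (k l : R) :
  (0 <= k)%R -> (0 <= l)%R -> rectifiable_in Om c ->
  nonneg_borel_on Om g -> nonneg_borel_on Om h ->
  line_integral c (fun x => k%:E * g x + l%:E * h x) =
  k%:E * line_integral c g + l%:E * line_integral c h.
Proof.
move=> k0 l0 rc Bg Bh; rewrite /line_integral ge0_integralD//.
- rewrite !ge0_integralZl_EFin//.
  + by move=> t ht; exact: nonneg_along_curve Bh ht.
  + exact: measurable_along_curve Bh.
  + by move=> t ht; exact: nonneg_along_curve Bg ht.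
  + exact: measurable_along_curve Bg.
- by move=> t ht; rewrite mule_ge0 ?lee_fin//; exact: nonneg_along_curve Bg ht.
- by apply: measurable_funeM; exact: measurable_along_curve Bg.
- by move=> t ht; rewrite mule_ge0 ?lee_fin//; exact: nonneg_along_curve Bh ht.
- by apply: measurable_funeM; exact: measurable_along_curve Bh.
Qed.

Lemma nonneg_borel_lincomb (g h : X -> \bar R) (k l : R) :
  (0 <= k)%R -> (0 <= l)%R -> nonneg_borel_on Om g -> nonneg_borel_on Om h ->
  nonneg_borel_on Om (fun x => k%:E * g x + l%:E * h x).
Proof.
move=> k0 l0 [mg g0] [mh h0]; split.
  have mO := open_measurable_borel.
  by apply: emeasurable_funD; exact: measurable_funeM.
by move=> x Ox; rewrite adde_ge0// mule_ge0 ?lee_fin ?g0 ?h0.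
Qed.

End curves.

(** * Minimal weak upper gradients *)

Section newtonian.
Context {R : realType} {X : completeMetricType R}.
Variables (mu : {outer_measure set X -> \bar R}) (Om : set X).
Hypothesis mu_borel :
  forall A : set X, (@open X).-sigma.-measurable A -> mu.-cara.-measurable A.
Hypothesis oOm : open Om.
Variables p q a : X -> R.
Hypothesis dp : double_phase_on (cara mu) Om p q a.
Let Phi := double_phase p q a.

Lemma open_measurable_cara : mu.-cara.-measurable Om.
Proof. by apply: mu_borel; exact: open_measurable_borel. Qed.

Lemma nonneg_borel_cara (h : X -> \bar R) : nonneg_borel_on Om h ->
  measurable_fun (Om : set (caratheodory_type mu)) h.
Proof.
move=> [mh _] _ B mB; apply: mu_borel.
by apply: (mh _ _ mB); exact: open_measurable_borel.
Qed.

Let mO := open_measurable_cara.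

Lemma curve_modulus_ge0 (Gamma : set (@curve R X)) :
  0 <= curve_modulus mu Om Phi Gamma.
Proof.
apply: le_ereal_inf_tmp => _ [h [_ _] <-]; apply: integral_ge0 => x Ox.
exact: (double_phase_ge0 dp).
Qed.

Lemma curve_modulus0P (Gamma : set (@curve R X)) (e : R) : (0 < e)%R ->
  curve_modulus mu Om Phi Gamma = 0 ->
  exists h, [/\ nonneg_borel_on Om h,
    (forall c, Gamma c -> 1 <= line_integral c h) &
    \int[cara mu]_(x in Om) Phi x (h x) < e%:E].
Proof.
move=> e0 G0; have : curve_modulus mu Om Phi Gamma < e%:E by rewrite G0 lte_fin.
by move=> /ereal_inf_lt[_ [h [Bh Gh] <-] he]; exists h.
Qed.

(** The maximum of two admissible functions is admissible for the union, and its modular is at most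
    the sum because [Phi] at a maximum is one of the two values. *)
Lemma curve_modulus_setU0 (G1 G2 : set (@curve R X)) :
  G1 `<=` rectifiable_in Om -> G2 `<=` rectifiable_in Om ->
  curve_modulus mu Om Phi G1 = 0 -> curve_modulus mu Om Phi G2 = 0 ->
  curve_modulus mu Om Phi (G1 `|` G2) = 0.
Proof.
move=> r1 r2 G10 G20; apply/eqP; rewrite eq_le curve_modulus_ge0 andbT.
apply/lee_addgt0Pr => e e0; rewrite add0e.
have e20 : (0 < e / 2)%R by rewrite divr_gt0.
have [h1 [B1 L1 I1]] := curve_modulus0P e20 G10.
have [h2 [B2 L2 I2]] := curve_modulus0P e20 G20.
have [m1 p1] := B1; have [m2 p2] := B2.
have Bmax : nonneg_borel_on Om (fun x => maxe (h1 x) (h2 x)).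
  split; first exact: measurable_maxe.
  by move=> x Ox; rewrite le_max p1.
have lemax (c : curve) (h : X -> \bar R) : rectifiable_in Om c ->
    nonneg_borel_on Om h -> (forall x, h x <= maxe (h1 x) (h2 x)) ->
    line_integral c h <= line_integral c (fun x => maxe (h1 x) (h2 x)).
  move=> rc Bh hm; apply: le_lower_integral => // t ht.
  exact: (nonneg_along_curve rc Bh ht).
apply: (@le_trans _ _
    (\int[cara mu]_(x in Om) Phi x (maxe (h1 x) (h2 x)))).
  apply: ereal_inf_lbound; exists (fun x => maxe (h1 x) (h2 x)) => //.
  split=> // c [/[dup] Gc /r1 rc|/[dup] Gc /r2 rc].
    apply: le_trans (L1 _ Gc) _; apply: lemax => // x.
    by rewrite le_max lexx.
  apply: le_trans (L2 _ Gc) _; apply: lemax => // x.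
  by rewrite le_max lexx orbT.
apply: (@le_trans _ _
    (\int[cara mu]_(x in Om) (Phi x (h1 x) + Phi x (h2 x)))).
  apply: le_lower_integral => x Ox; first exact: (double_phase_ge0 dp).
  have P0 := double_phase_ge0 dp _ Ox.
  by rewrite /maxe; case: ifPn => _; rewrite ?leeDl ?leeDr ?P0.
rewrite ge0_integralD//.
- by rewrite (splitr e) EFinD leeD// ltW.
- by move=> x Ox; exact: (double_phase_ge0 dp).
- by apply: (measurable_double_phase mO dp) => //; exact: nonneg_borel_cara.
- by move=> x Ox; exact: (double_phase_ge0 dp).
- by apply: (measurable_double_phase mO dp) => //; exact: nonneg_borel_cara.
Qed.

(** The distance bound is applied at the endpoints of every curve outside the union of the two
    exceptional families. Stated through distances, it covers both linear combinations and the
    estimate of [u] by [v] and [v - u]. *)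
Lemma weak_upper_gradient_dom (u v w g h : X -> \bar R) (k l : R) :
  (0 <= k)%R -> (0 <= l)%R ->
  (forall x y, `|w x - w y| <= k%:E * `|u x - u y| + l%:E * `|v x - v y|) ->
  weak_upper_gradient mu Om Phi u g -> weak_upper_gradient mu Om Phi v h ->
  weak_upper_gradient mu Om Phi w (fun x => k%:E * g x + l%:E * h x).
Proof.
move=> k0 l0 wuv [Bg [G1 [r1 G10 H1]]] [Bh [G2 [r2 G20 H2]]]; split.
  exact: nonneg_borel_lincomb.
exists (G1 `|` G2); split.
- by move=> c [/r1|/r2].
- exact: curve_modulus_setU0.
move=> c rc /not_orP[G1c G2c]; rewrite (line_integral_lincomb oOm)//.
apply: le_trans (wuv _ _) _.
by rewrite leeD// lee_wpmul2l ?lee_fin// ?H1 ?H2.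
Qed.

Lemma orlicz_lincomb_ge0 (g h : X -> \bar R) (k l : R) :
  (0 <= k)%R -> (0 <= l)%R ->
  orlicz_space (cara mu) Om Phi g -> orlicz_space (cara mu) Om Phi h ->
  orlicz_space (cara mu) Om Phi (fun x => k%:E * g x + l%:E * h x).
Proof.
move=> k0 l0 Og Oh.
apply: (orlicz_dom mO dp (K := (k + l)%R) _ _ Og Oh).
  by apply: emeasurable_funD; apply: measurable_funeM; [case: Og|case: Oh].
move=> x Ox; apply: le_trans (abse_lincomb_le _ _ _ _) _.
rewrite ge0_muleDr ?abse_ge0// leeD// lee_wpmul2r// lee_fin ger0_norm//.
  by rewrite lerDl.
by rewrite lerDr.
Qed.

(** * The chosen minimal weak upper gradient *)

Variable gr : (X -> \bar R) -> X -> \bar R.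
Hypothesis gr_minimal : minimal_wug_map mu Om Phi gr.

Lemma gr_minimal_wug (u : X -> \bar R) : N1 mu Om Phi u ->
  minimal_wug mu Om Phi u (gr u).
Proof. by move=> [[mu' _] hu]; exact: gr_minimal. Qed.

Lemma gr_ge0 (u : X -> \bar R) x : N1 mu Om Phi u -> Om x -> 0 <= gr u x.
Proof. by move=> /gr_minimal_wug[[[_ g0] _] _ _]; exact: g0. Qed.

Lemma gr_orlicz (u : X -> \bar R) : N1 mu Om Phi u ->
  orlicz_space (cara mu) Om Phi (gr u).
Proof. by move=> /gr_minimal_wug[]. Qed.

Lemma gr_measurable (u : X -> \bar R) : N1 mu Om Phi u ->
  measurable_fun (Om : set (caratheodory_type mu)) (gr u).
Proof. by move=> /gr_orlicz[]. Qed.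

(** Minimality of [gr w] against the competitor [k g_u + l g_v], itself a weak upper gradient of [w]
    in the Orlicz space. *)
Lemma gr_le (u v w : X -> \bar R) (k l : R) :
  (0 <= k)%R -> (0 <= l)%R ->
  (forall x y, `|w x - w y| <= k%:E * `|u x - u y| + l%:E * `|v x - v y|) ->
  N1 mu Om Phi u -> N1 mu Om Phi v -> N1 mu Om Phi w ->
  {ae cara mu, forall x, Om x -> gr w x <= k%:E * gr u x + l%:E * gr v x}.
Proof.
move=> k0 l0 wuv Nu Nv /gr_minimal_wug[_ _]; apply.
  apply: weak_upper_gradient_dom => //; first by case: (gr_minimal_wug Nu).
  by case: (gr_minimal_wug Nv).
by apply: orlicz_lincomb_ge0 => //; exact: gr_orlicz.
Qed.

Lemma N1_lincomb (u v : X -> \bar R) (k l : R) :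
  N1 mu Om Phi u -> N1 mu Om Phi v ->
  N1 mu Om Phi (fun x => k%:E * u x + l%:E * v x).
Proof.
move=> Nu Nv; have [[[mu' uoo] _] [[mv voo] _]] := (Nu, Nv); split.
  apply: (orlicz_dom mO dp (u := u) (v := v) (K := (`|k| + `|l|)%R)) => //.
    by apply: emeasurable_funD; exact: measurable_funeM.
  move=> x Ox; apply: le_trans (abse_lincomb_le _ _ _ _) _.
  by rewrite ge0_muleDr ?abse_ge0// leeD// lee_wpmul2r// lee_fin ?lerDl ?lerDr.
exists (fun x => `|k|%:E * gr u x + `|l|%:E * gr v x).
  apply: (@weak_upper_gradient_dom u v) => //.
  - by move=> x y; exact: lincomb_dist.
  - by case: (gr_minimal_wug Nu).
  - by case: (gr_minimal_wug Nv).
by apply: orlicz_lincomb_ge0 => //; exact: gr_orlicz.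
Qed.

Lemma N1B (u v : X -> \bar R) : N1 mu Om Phi u -> N1 mu Om Phi v ->
  N1 mu Om Phi (fun x => u x - v x).
Proof.
move=> Nu Nv; have := N1_lincomb 1 (-1) Nu Nv.
by under eq_fun do rewrite mul1e EFinN mulN1e.
Qed.

Lemma N1norm_lt (u : X -> \bar R) (e : R) : N1norm mu Om Phi gr u < e%:E ->
  luxnorm (cara mu) Om Phi u < e%:E /\ luxnorm (cara mu) Om Phi (gr u) < e%:E.
Proof.
by move=> ue; split; apply: le_lt_trans ue; [rewrite leeDl|rewrite leeDr];
  rewrite ?luxnorm_ge0.
Qed.

End newtonian.

(** * Gradient and trace parts of the energy *)

Section energy_functional.
Context {R : realType} {X : completeMetricType R}.
Variables (mu nu : {outer_measure set X -> \bar R}) (Om : set X).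
Hypothesis mu_borel :
  forall A : set X, (@open X).-sigma.-measurable A -> mu.-cara.-measurable A.
Hypothesis nu_borel :
  forall A : set X, (@open X).-sigma.-measurable A -> nu.-cara.-measurable A.
Hypothesis oOm : open Om.
Variables p q a : X -> R.
Hypothesis dp : double_phase_on (cara mu) Om p q a.
Hypothesis dpb : double_phase_on (cara nu) (bd Om) p q a.
Let Phi := double_phase p q a.
Let A := energy_density p q a.
Variable gr : (X -> \bar R) -> X -> \bar R.
Hypothesis gr_minimal : minimal_wug_map mu Om Phi gr.
Variable T : (X -> \bar R) -> X -> \bar R.
Hypothesis T_trace : trace_operator mu Om Phi nu gr T.
Variable f : X -> \bar R.
Hypothesis f_dual : orlicz_space (cara nu) (bd Om) (complementary Phi) f.

Let mO : mu.-cara.-measurable Om.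
Proof. exact: open_measurable_cara. Qed.

Let measurable_bd : nu.-cara.-measurable (bd Om).
Proof.
apply: nu_borel; apply: (@measurableD _ (@borelType R X)).
  rewrite -[closure _]setCK; apply: (@measurableC _ (@borelType R X)).
  by apply: sub_sigma_algebra; exact/closed_openC/closed_closure.
by apply: sub_sigma_algebra; exact: open_interior.
Qed.

Lemma energy_densityE x xi :
  A x xi = two_power (p x)^-1 (a x / q x) (p x) (q x) xi.
Proof. by []. Qed.

Let p1 x : Om x -> (1 <= p x)%R. Proof. exact: (dp_p_ge1 dp). Qed.
Let q1 x : Om x -> (1 <= q x)%R. Proof. exact: (dp_q_ge1 dp). Qed.
Let a0 x : Om x -> (0 <= a x)%R. Proof. exact: (dp_weight dp). Qed.

Let b0 x : Om x -> (0 <= (p x)^-1)%R.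
Proof. by move=> Ox; rewrite invr_ge0 (le_trans _ (p1 Ox)). Qed.

Let c0 x : Om x -> (0 <= a x / q x)%R.
Proof. by move=> Ox; rewrite divr_ge0 ?a0// (le_trans _ (q1 Ox)). Qed.

Lemma energy_density_ge0 x xi : Om x -> 0 <= A x xi.
Proof. by move=> Ox; rewrite energy_densityE two_power_ge0 ?b0 ?c0. Qed.

(** Because [1 / p] and [1 / q] are at most 1. It gives finiteness of the gradient energy and lets
    modular bounds control it. *)
Lemma energy_density_le x xi : Om x -> A x xi <= Phi x xi.
Proof.
move=> Ox; rewrite energy_densityE /Phi double_phaseE le_two_power_coef//.
  by rewrite invf_le1 ?p1// (lt_le_trans ltr01 (p1 Ox)).
by rewrite ler_pdivrMr ?(lt_le_trans ltr01 (q1 Ox))// ler_peMr ?a0 ?q1.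
Qed.

Lemma measurable_energy_density (h : X -> \bar R) :
  (forall x, Om x -> 0 <= h x) ->
  measurable_fun (Om : set (caratheodory_type mu)) h ->
  measurable_fun (Om : set (caratheodory_type mu)) (fun x => A x (h x)).
Proof.
move=> h0 mh.
have mp := dp_measurable_p dp; have mq := dp_measurable_q dp.
have ma := dp_measurable_a dp.
apply: (measurable_two_power mO (b := fun x => (p x)^-1%R)
  (c := fun x => (a x / q x)%R)) => //.
- by move=> x Ox; exact: lt_le_trans (p1 Ox).
- by move=> x Ox; exact: lt_le_trans (q1 Ox).
- by apply: (measurable_fun_invr_ge0 mO) => // x Ox; exact: le_trans (p1 Ox).
- apply: measurable_funM => //; apply: (measurable_fun_invr_ge0 mO) => // x Ox.
  exact: le_trans (q1 Ox).
Qed.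

Let E1 (u : X -> \bar R) := \int[cara mu]_(x in Om) A x (gr u x).
Let E2 (u : X -> \bar R) := \int[cara nu]_(z in bd Om) (f z * T u z).

Lemma measurable_energy_gr (u : X -> \bar R) : N1 mu Om Phi u ->
  measurable_fun (Om : set (caratheodory_type mu)) (fun x => A x (gr u x)).
Proof.
move=> Nu; apply: measurable_energy_density.
  by move=> x; exact: (gr_ge0 gr_minimal Nu).
exact: (gr_measurable gr_minimal Nu).
Qed.

Lemma gradient_energy_fin_num (u : X -> \bar R) : N1 mu Om Phi u ->
  E1 u \is a fin_num.
Proof.
move=> Nu; rewrite ge0_fin_numE; last first.
  by apply: integral_ge0 => x; exact: energy_density_ge0.
have [_] := gr_orlicz gr_minimal Nu; apply: le_lt_trans.
apply: le_lower_integral => x Ox; first exact: energy_density_ge0.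
by rewrite gee0_abs ?energy_density_le// (gr_ge0 gr_minimal Nu).
Qed.

Lemma trace_integrable (u : X -> \bar R) : N1 mu Om Phi u ->
  (cara nu).-integrable (bd Om) (fun z => f z * T u z).
Proof.
move=> Nu; apply: (orlicz_dual_integrable measurable_bd dpb) => //.
exact: (trace_orlicz T_trace).
Qed.

Lemma trace_energy_fin_num (u : X -> \bar R) : N1 mu Om Phi u ->
  E2 u \is a fin_num.
Proof. by move=> Nu; apply: integrable_fin_num => //; exact: trace_integrable. Qed.

Lemma trace_energy_lincomb (u v : X -> \bar R) (k l : R) :
  N1 mu Om Phi u -> N1 mu Om Phi v ->
  E2 (fun x => k%:E * u x + l%:E * v x) = k%:E * E2 u + l%:E * E2 v.
Proof.
move=> Nu Nv; have Iu := trace_integrable Nu; have Iv := trace_integrable Nv.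
have Nw := N1_lincomb mu_borel oOm dp gr_minimal k l Nu Nv.
have Iw := trace_integrable Nw.
rewrite /E2 -!integralZl// -integralD//; try exact: integrableZl.
apply: ae_eq_integral => //.
- exact: (measurable_int _ Iw).
- by apply: emeasurable_funD; apply: measurable_funeM;
    [exact: (measurable_int _ Iu)|exact: (measurable_int _ Iv)].
(* Distributivity can fail at infinite values; almost everywhere [f], [T u] and [T v] are finite and
   the identity is one of real numbers. *)
have ff := orlicz_dual_ae_fin_num measurable_bd dpb f_dual.
have fu := orlicz_ae_fin_num measurable_bd dpb (trace_orlicz T_trace Nu).
have fv := orlicz_ae_fin_num measurable_bd dpb (trace_orlicz T_trace Nv).
have := trace_linear T_trace k l Nu Nv.
apply: filterS3 ff (filterI fu fv) => z fz [uz vz] Tz bz.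
rewrite Tz//; move: (fz bz) (uz bz) (vz bz).
case: (f z) => // s _; case: (T u z) => // s1 _; case: (T v z) => // s2 _.
by rewrite -!EFinM -!EFinD; congr EFin; ring.
Qed.

Lemma gradient_energy_convex (u v : X -> \bar R) (t : R) : (0 <= t <= 1)%R ->
  N1 mu Om Phi u -> N1 mu Om Phi v ->
  E1 (fun x => t%:E * u x + (1 - t)%:E * v x) <= t%:E * E1 u + (1 - t)%:E * E1 v.
Proof.
move=> /[dup] t01 /andP[t0 t1] Nu Nv; have t'0 : (0 <= 1 - t)%R by rewrite subr_ge0.
have Nw := N1_lincomb mu_borel oOm dp gr_minimal t (1 - t)%R Nu Nv.
have gu0 := gr_ge0 gr_minimal Nu; have gv0 := gr_ge0 gr_minimal Nv.
have mu' := measurable_energy_gr Nu; have mv := measurable_energy_gr Nv.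
rewrite /E1 -!ge0_integralZl_EFin//; try by move=> x; exact: energy_density_ge0.
rewrite -ge0_integralD//; try exact: measurable_funeM;
  try by move=> x Ox; rewrite mule_ge0 ?lee_fin// energy_density_ge0.
apply: ae_ge0_le_integral => //.
- by move=> x; exact: energy_density_ge0.
- exact: measurable_energy_gr.
- by move=> x Ox; rewrite adde_ge0// mule_ge0 ?lee_fin// energy_density_ge0.
- by apply: emeasurable_funD; exact: measurable_funeM.
pose w := fun x => t%:E * u x + (1 - t)%:E * v x.
have dist x y :
    `|w x - w y| <= t%:E * `|u x - u y| + (1 - t)%:E * `|v x - v y|.
  by have := lincomb_dist t (1 - t) (u x) (u y) (v x) (v y); rewrite !ger0_norm.
have grw := gr_le mu_borel oOm dp gr_minimal t0 t'0 dist Nu Nv Nw.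
apply: (@filterS _ _ (ae_filter_ringOfSetsType (cara mu)) _ _ _ grw) => x H Ox.
rewrite !energy_densityE; apply: le_trans (two_power_convex _ _ _ _ t01 _ _);
  rewrite ?b0 ?c0 ?p1 ?q1 ?gu0 ?gv0//.
by apply: le_two_power; rewrite ?b0 ?c0 ?p1 ?q1 ?(gr_ge0 gr_minimal Nw) ?H.
Qed.

(* With g_u <= g_v + g_w for w = v - u, convexity splits the argument
   (1 - e) g_u <= (1 - e) g_v + e (g_w / e), and the second term has modular at
   most 1; the power growth takes the factor 1 - e out on the left. *)
Lemma gradient_energy_lsc (u v : X -> \bar R) (e : R) (n : nat) :
  (e < 1)%R ->
  {ae cara mu, forall x, Om x -> (p x <= n%:R)%R /\ (q x <= n%:R)%R} ->
  N1 mu Om Phi u -> N1 mu Om Phi v ->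
  luxnorm (cara mu) Om Phi (gr (fun x => v x - u x)) < e%:E ->
  ((1 - e) ^+ n)%:E * E1 u <= E1 v + e%:E.
Proof.
move=> e1 pqn Nu Nv we; have e0 := luxnorm_lt_gt0 we.
have e1' : (0 <= 1 - e)%R by rewrite subr_ge0 ltW.
have e01 : (0 <= 1 - e <= 1)%R by apply/andP; split; lra.
pose w := fun x => v x - u x.
have Nw : N1 mu Om Phi w by exact: (N1B mu_borel oOm dp gr_minimal).
have gu0 := gr_ge0 gr_minimal Nu; have gv0 := gr_ge0 gr_minimal Nv.
have gw0 := gr_ge0 gr_minimal Nw.
have mgw : measurable_fun (Om : set (caratheodory_type mu))
    (fun x => Phi x `|(e^-1)%:E * gr w x|).
  by apply: (measurable_modular mO dp); apply: measurable_funeM;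
    exact: (gr_measurable gr_minimal Nw).
apply: (@le_trans _ _ (\int[cara mu]_(x in Om)
    (A x (gr v x) + e%:E * Phi x `|(e^-1)%:E * gr w x|))); last first.
  rewrite ge0_integralD//.
  - rewrite leeD2l// ge0_integralZl_EFin ?(ltW e0)//; last first.
      by move=> x Ox; exact: (double_phase_ge0 dp).
    rewrite -[leRHS]mule1; apply: lee_wpmul2l; first by rewrite lee_fin ltW.
    exact: (luxnorm_lt dp we).
  - by move=> x; exact: energy_density_ge0.
  - exact: measurable_energy_gr.
  - move=> x Ox; rewrite mule_ge0 ?lee_fin ?(ltW e0)//.
    exact: (double_phase_ge0 dp).
  - exact: measurable_funeM.
rewrite /E1 -ge0_integralZl_EFin ?exprn_ge0//; last 2 first.
- by move=> x; exact: energy_density_ge0.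
- exact: measurable_energy_gr.
apply: ae_ge0_le_integral => //.
- by move=> x Ox; rewrite mule_ge0 ?lee_fin ?exprn_ge0// energy_density_ge0.
- by apply: measurable_funeM; exact: measurable_energy_gr.
- move=> x Ox; rewrite adde_ge0 ?energy_density_ge0// mule_ge0 ?lee_fin ?(ltW e0)//.
  exact: (double_phase_ge0 dp).
- by apply: emeasurable_funD; [exact: measurable_energy_gr|exact: measurable_funeM].
have dist x y : `|u x - u y| <= 1%:E * `|v x - v y| + 1%:E * `|w x - w y|.
  by rewrite !mul1e; exact: dist_le_sub.
have gru := gr_le mu_borel oOm dp gr_minimal ler01 ler01 dist Nv Nw Nu.
apply: (@filterS2 _ _ (ae_filter_ringOfSetsType (cara mu)) _ _ _ _ pqn gru).
move=> x Hn H Ox; have [pn qn] := Hn Ox.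
have := H Ox; rewrite !mul1e => {}H.
have gw0' : 0 <= (e^-1)%:E * gr w x.
  by rewrite mule_ge0 ?gw0 ?lee_fin ?invr_ge0 ?ltW.
have gvw0 : 0 <= (1 - e)%:E * gr v x by rewrite mule_ge0 ?gv0.
rewrite (gee0_abs gw0') energy_densityE.
apply: le_trans (two_power_contract (b0 Ox) (c0 Ox) _ pn qn (gu0 _ Ox)) _.
  by apply/andP; split; lra.
(* Here [(1 - e) g_w <= g_w = e (g_w / e)]; the weight [e] is written [1 - (1 - e)] to match
   convexity with [k = 1 - e]. *)
have step : (1 - e)%:E * gr u x <=
    (1 - e)%:E * gr v x + (1 - (1 - e))%:E * ((e^-1)%:E * gr w x).
  apply: le_trans (lee_wpmul2l _ H) _; first by rewrite lee_fin.
  rewrite ge0_muleDr ?gv0 ?gw0// leeD2l// muleA -EFinM.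
  have -> : ((1 - (1 - e)) * e^-1 = 1 :> R)%R.
    by rewrite opprB addrC subrK mulfV ?gt_eqF.
  by apply: lee_wpmul2r; rewrite ?gw0// lee_fin; lra.
apply: le_trans (le_two_power _ _ _ _ _ step) _;
  rewrite ?b0 ?c0 ?p1 ?q1 ?mule_ge0 ?gu0//.
apply: le_trans (two_power_convex _ _ _ _ e01 _ _) _;
  rewrite ?b0 ?c0 ?p1 ?q1 ?gv0//.
have -> : (1 - (1 - e) = e :> R)%R by lra.
(* The factor [1 - e <= 1] in front of the density at [g_v] is dropped, and in the other term [A] is
   bounded by [Phi]. *)
apply: leeD.
  rewrite -energy_densityE -[leRHS]mul1e lee_wpmul2r ?energy_density_ge0//.
  by rewrite lee_fin; lra.
by apply: lee_wpmul2l; [rewrite lee_fin ltW|exact: energy_density_le].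
Qed.

Lemma trace_energy_lipschitz : exists2 C : R, (0 <= C)%R &
  forall (u v : X -> \bar R) (e : R), N1 mu Om Phi u -> N1 mu Om Phi v ->
    N1norm mu Om Phi gr (fun x => v x - u x) < e%:E ->
    `|E2 v - E2 u| <= (C * e)%:E.
Proof.
have [C HC] := trace_bounded T_trace; have [mf foo] := f_dual.
set M := modular _ _ _ _ in foo.
have [K K0 MK] : exists2 K : R, (0 <= K)%R & M <= K%:E.
  case: M foo => [M _|//|_]; last by exists 0%R; rewrite ?leNye.
  by exists (Num.max 0%R M); rewrite ?lee_fin le_max lexx ?orbT.
(* The norm of [T (v - u)] is strictly below [(|C| + 1) e], the extra 1 giving strictness; Young's
   inequality then contributes the modular of [f] plus 1, at most [K + 1]. *)
exists ((`|C| + 1) * (K + 1))%R; first by rewrite mulr_ge0 ?addr_ge0.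
move=> u v e Nu Nv we; have Nw := N1B mu_borel oOm dp gr_minimal Nv Nu.
have [we1 _] := N1norm_lt we; have e0 := luxnorm_lt_gt0 we1.
have -> : E2 v - E2 u = E2 (fun x => v x - u x).
  rewrite -[E2 v]mul1e -mulN1e -(trace_energy_lincomb 1 (-1) Nv Nu).
  by congr E2; apply/funext => x; rewrite mul1e EFinN mulN1e.
apply: le_trans (le_abse_integral _ _ (measurable_int _ (trace_integrable Nw))) _ => //.
have [mT _] := trace_orlicz T_trace Nw.
have Tw : luxnorm (cara nu) (bd Om) Phi (T (fun x => v x - u x)) <
    ((`|C| + 1) * e)%:E.
  apply: le_lt_trans (HC _ Nw) _.
  apply: (@le_lt_trans _ _ (`|C|%:E * e%:E)).
    apply: (@le_trans _ _ (`|C|%:E * N1norm mu Om Phi gr (fun x => v x - u x))).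
      apply: lee_wpmul2r; first by rewrite adde_ge0 ?luxnorm_ge0.
      by rewrite lee_fin ler_norm.
    by apply: lee_wpmul2l; [rewrite lee_fin|exact: ltW].
  by rewrite -EFinM lte_fin ltr_pM2r// ltrDl.
apply: le_trans (young_luxnorm measurable_bd dpb mf mT Tw) _.
rewrite mulrAC [leRHS]EFinM; apply: lee_wpmul2l.
  by rewrite lee_fin mulr_ge0 ?addr_ge0// ltW.
by rewrite EFinD leeD2r.
Qed.

End energy_functional.

(** * Minimizers *)

Lemma lincombD (R : realDomainType) (k l : R) (x x' y y' : \bar R) :
  x \is a fin_num -> x' \is a fin_num -> y \is a fin_num -> y' \is a fin_num ->
  k%:E * (x + x') + l%:E * (y + y') =
  (k%:E * x + l%:E * y) + (k%:E * x' + l%:E * y').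
Proof.
by move=> xf x'f yf y'f; rewrite !muleDr ?fin_num_adde_defr// addeACA.
Qed.

Lemma bernoulli_le (R : realDomainType) (e : R) (n : nat) : (0 <= e <= 1)%R ->
  (1 - n%:R * e <= (1 - e) ^+ n)%R.
Proof.
move=> /andP[e0 e1]; elim: n => [|n IH]; first by rewrite mul0r subr0 expr0.
have n0 : (0 <= n%:R :> R)%R by [].
rewrite exprS; have := ler_wpM2l (x := (1 - e)%R) _ IH.
rewrite subr_ge0 e1 => /(_ isT); apply: le_trans.
(* Expanding [(1 - e) (1 - n e)] leaves the nonnegative surplus [n e^2]. *)
rewrite -natr1; have : (0 <= n%:R * (e * e))%R by rewrite !mulr_ge0.
nra.
Qed.

(** Passage to the limit [e -> 0] when the estimate is available only for [e] below 1. *)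
Lemma le_limit0 (R : realFieldType) (x y K : R) :
  (forall e : R, (0 < e < 1)%R -> (x <= y + e * K)%R) -> (x <= y)%R.
Proof.
move=> H; apply/ler_addgt0Pr => d d0.
have K1 : (0 < `|K| + 1)%R by rewrite ltr_wpDl.
(* The first entry keeps [e] below 1, the second makes [e * K] at most [d]. *)
pose e := Num.min (2^-1)%R (d / (`|K| + 1))%R.
have e0 : (0 < e)%R by rewrite lt_min invr_gt0 ltr0n divr_gt0.
have e1 : (e < 1)%R by rewrite gt_min invf_lt1 ?ltr1n ?ltr0n.
apply: le_trans (H e _) _; first by rewrite e0.
rewrite lerD2l; apply: (@le_trans _ _ (e * (`|K| + 1))%R).
  by rewrite ler_pM2l// (le_trans (ler_norm _))// lerDl.
by rewrite -ler_pdivlMr// ge_min lexx orbT.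
Qed.

Theorem theorem4p2 (R : realType) (X : completeMetricType R)
  (mu : {outer_measure set X -> \bar R})
  (mu_regular : borel_regular mu)
  (mu_sigma_finite : sigma_finite setT (cara mu))
  (mu_ball : forall (x : X) (r : R), (0 < r)%R ->
     0 < mu (ball x r) /\ mu (ball x r) < +oo)
  (Om : set X)
  (Om_domain : is_domain Om)
  (Om_ball : forall (x : X) (r : R), closure Om x -> (0 < r)%R ->
     0 < mu (ball x r `&` Om) /\ mu (ball x r `&` Om) < +oo)
  (mu_doubling : restricted_doubling mu Om)
  (* the boundary measure, extended by zero to X *)
  (nu : {outer_measure set X -> \bar R})
  (nu_boundary : nu (~` bd Om) = 0)
  (nu_regular : borel_regular nu)
  (nu_sigma_finite : sigma_finite setT (cara nu))
  (theta : R) (theta_ge0 : (0 <= theta)%R) (theta_lt1 : (theta < 1)%R)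
  (nu_codim : upper_codimension mu nu Om theta)
  (p q a : X -> R)
  (dp_closure : double_phase_on (cara mu) (closure Om) p q a)
  (dp_boundary : double_phase_on (cara nu) (bd Om) p q a)
  (Om_bounded : metric_bounded Om)
  (comparable : local_comparability (double_phase p q a) (closure Om))
  (poincare : weak_poincare mu Om (double_phase p q a))
  (gr : (X -> \bar R) -> X -> \bar R)
  (gr_minimal : minimal_wug_map mu Om (double_phase p q a) gr)
  (T : (X -> \bar R) -> X -> \bar R)
  (T_trace : trace_operator mu Om (double_phase p q a) nu gr T)
  (f : X -> \bar R)
  (f_dual : orlicz_space (cara nu) (bd Om) (complementary (double_phase p q a)) f)
  (f_mean0 : \int[cara nu]_(z in bd Om) f z = 0) :
  fun_convex (minimizers mu nu Om p q a gr T f) /\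
  N1closed mu Om (double_phase p q a) gr (minimizers mu nu Om p q a gr T f).
Proof.
have [mu_borel _] := mu_regular; have [nu_borel _] := nu_regular.
have [oOm _ _] := Om_domain.
have dp : double_phase_on (cara mu) Om p q a.
  apply: double_phase_onS dp_closure; last exact: subset_closure.
  apply: mu_borel; rewrite -[closure _]setCK.
  apply: (@measurableC _ (@borelType R X)).
  by apply: sub_sigma_algebra; exact/closed_openC/closed_closure.
have mO := open_measurable_cara mu_borel oOm.
have muOm : mu Om < +oo.
  have [x [r Omr]] := Om_bounded.
  (* The radius from boundedness may be nonpositive, so it is enlarged to at least 1. *)
  apply: (@le_lt_trans _ _ (mu (ball x (Num.max r 1)%R))).
    apply: le_outer_measure; apply: subset_trans Omr _.
    by apply: le_ball; rewrite le_max lexx.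
  by have [] := @mu_ball x (Num.max r 1)%R; rewrite // lt_max ltr01 orbT.
have int u : N1 mu Om (double_phase p q a) u -> (cara mu).-integrable Om u.
  by move=> [Ou _]; exact: (orlicz_integrable mO dp).
have fin u : N1 mu Om (double_phase p q a) u ->
    energy mu nu Om p q a gr T f u \is a fin_num.
  move=> Nu; rewrite fin_numD; apply/andP; split.
    exact: (gradient_energy_fin_num dp gr_minimal Nu).
  exact: (trace_energy_fin_num nu_borel dp_boundary T_trace f_dual Nu).
have inf_le u : N1star mu Om (double_phase p q a) u ->
    min_energy mu nu Om p q a gr T f <= energy mu nu Om p q a gr T f u.
  by move=> Nu; apply: ereal_inf_lbound; exists u.
split.
- move=> u v t [[Nu u0] Eu] [[Nv v0] Ev] t01; have /andP[t0 t1] := t01.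
  have Nw : N1star mu Om (double_phase p q a)
      (fun x => t%:E * u x + (1 - t)%:E * v x).
    split; first exact: (N1_lincomb mu_borel oOm dp gr_minimal).
    rewrite integralD//; [|exact/integrableZl/int|exact/integrableZl/int].
    rewrite !integralZl//; [|exact: int|exact: int].
    by rewrite u0 v0 !mule0 adde0.
  split => //; apply/eqP; rewrite eq_le inf_le// andbT.
  have I_fin : min_energy mu nu Om p q a gr T f \is a fin_num.
    by rewrite -Eu; exact: fin.
  (* The infimum is rewritten as the convex combination of the two equal minimal energies, so that
     convexity compares term by term. *)
  have -> : min_energy mu nu Om p q a gr T f =
      t%:E * energy mu nu Om p q a gr T f u +
      (1 - t)%:E * energy mu nu Om p q a gr T f v.
    rewrite Eu Ev -ge0_muleDl ?lee_fin ?subr_ge0//.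
    by rewrite -EFinD addrC subrK mul1e.
  have E1u := gradient_energy_fin_num dp gr_minimal Nu.
  have E1v := gradient_energy_fin_num dp gr_minimal Nv.
  have E2u := trace_energy_fin_num nu_borel dp_boundary T_trace f_dual Nu.
  have E2v := trace_energy_fin_num nu_borel dp_boundary T_trace f_dual Nv.
  rewrite /energy lincombD//; apply: leeD.
    exact: (gradient_energy_convex mu_borel oOm dp gr_minimal).
  by rewrite (trace_energy_lincomb mu_borel nu_borel oOm dp dp_boundary
    gr_minimal T_trace f_dual).
move=> u Nu u_lim.
have [n pqn] := dp_exponent_bound dp.
have [C C0 E2_lip] := trace_energy_lipschitz mu_borel nu_borel oOm dp dp_boundary
  gr_minimal T_trace f_dual.
(* The mean-zero constraint passes to the limit: the integral of [u] equals that of [u - v], whose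
   absolute value is at most [e (mu Om + 1)]. *)
have u0 : \int[cara mu]_(x in Om) u x = 0.
  apply/eqP; rewrite -abse_eq0; apply/eqP/le_anti; rewrite abse_ge0 andbT.
  have ufin := integrable_fin_num mO (int _ Nu).
  have mufin : mu Om \is a fin_num by rewrite ge0_fin_numE// outer_measure_ge0.
  rewrite -(fineK ufin) /= lee_fin; apply: (@le_limit0 _ _ _ (fine (mu Om) + 1)%R).
  move=> e /andP[e0 e1]; have [v [[Nv v0] _] vu] := u_lim e e0.
  have Nw := N1B mu_borel oOm dp gr_minimal Nv Nu.
  have [wl _] := N1norm_lt vu.
  have := luxnorm_lt_L1 mO dp (measurable_int _ (int _ Nw)) wl.
  move=> /(le_trans (le_abse_integral _ mO (measurable_int _ (int _ Nw)))).
  rewrite integralB//; [|exact: int|exact: int].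
  rewrite v0 add0e abseN -(fineK ufin) /=.
  by rewrite -lee_fin add0r EFinM EFinD fineK.
have Nus : N1star mu Om (double_phase p q a) u by [].
split => //; apply/eqP; rewrite eq_le inf_le// andbT.
have E1u := gradient_energy_fin_num dp gr_minimal Nu.
have E2u := trace_energy_fin_num nu_borel dp_boundary T_trace f_dual Nu.
(* Any radius serves here: one minimizer is enough to make the infimum finite. *)
have [v1 [[Nv1 _] Ev1] _] := u_lim 1%R ltr01.
have I_fin : min_energy mu nu Om p q a gr T f \is a fin_num.
  by rewrite -Ev1; exact: fin.
rewrite /energy -(fineK E1u) -(fineK E2u) -(fineK I_fin) -EFinD lee_fin.
set J1 := fine _; set J2 := fine _; set I := fine _.
have J10 : (0 <= J1)%R.
  by rewrite fine_ge0//; apply: integral_ge0 => x; exact: (energy_density_ge0 dp).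
(* The three errors are [n e J1] from Bernoulli's inequality applied to [(1 - e) ^+ n], [e] from the
   gradient estimate and [C e] from the trace. *)
apply: (@le_limit0 _ _ _ (n%:R * J1 + 1 + C)%R) => e /andP[e0 e1].
have [v [[Nv _] Ev] vu] := u_lim e e0.
have [_ gwl] := N1norm_lt vu.
have H1 := gradient_energy_lsc mu_borel oOm dp gr_minimal e1 pqn Nu Nv gwl.
have H2 := E2_lip _ _ _ Nu Nv vu.
have E1v := gradient_energy_fin_num dp gr_minimal Nv.
have E2v := trace_energy_fin_num nu_borel dp_boundary T_trace f_dual Nv.
move: Ev; rewrite /energy -(fineK I_fin) -(fineK E1v) -(fineK E2v) -EFinD.
move=> Ev; have {}Ev := EFin_inj Ev.
move: H1; rewrite -(fineK E1u) -(fineK E1v) -EFinM -EFinD lee_fin => H1.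
move: H2; rewrite -(fineK E2u) -(fineK E2v) -EFinB /= lee_fin ler_norml => /andP[H2 _].
have B : (1 - n%:R * e <= (1 - e) ^+ n)%R by apply: bernoulli_le; rewrite !ltW.
have := ler_wpM2r J10 B; move: H1 H2 Ev; rewrite -/J1 -/J2 -/I; lra.
Qed.
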